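(* Let $V$ be a set of $n+1$ positive integers ($n\ge0$). The map $\mathrm{DP}$ is a bijection between the set of all valid digraphs on the node set $V$ and the set of all balanced Delannoy words of length $2n$.
   Context: Arrows: for a finite node set $V\subseteq\mathbb{P}$, an arrow $(x,y)$ with $x\ne y$ in $V$ has tail $x$ and head $y$; it is forward if $x<y$ and backward if $x>y$. Its interval is $\{\min(x,y),\ldots,\max(x,y)\}$. Two arrows cross if their intervals $[a_1,a_2]$, $[b_1,b_2]$ satisfy $a_1<b_1<a_2<b_2$ or $b_1<a_1<b_2<a_2$; an arrow nests another if its interval contains the other's interval; two arrows nest if one nests the other. A valid digraph on $V$ is a set $A$ of arrows on $V$ such that: (1) no two arrows cross; (2) any two forward arrows nest; (3) no backward arrow nests a forward arrow; (4) no head of an arrow is the tail of another arrow. For $W\subseteq V$, $A_W$ is the set of arrows of $A$ with both endpoints in $W$ (a digraph on $W$). Words: letters $U$, $D$ (length 1) and $H$ (length 2), encoding steps $(1,1)$, $(1,-1)$, $(2,0)$. A balanced Delannoy word of length $2n$ is a word of total length $2n$ with equally many $U$'s and $D$'s (i.e. encoding a path from $(0,0)$ to $(2n,0)$); a Schröder word is one whose path never goes below the horizontal axis. $\epsilon$ is the empty word; $\cdot$ is concatenation. $\mathrm{SP}$: for a valid digraph $A$ of backward arrows on nonempty $V$ with $v=\min V$: if $V=\{v\}$, $\mathrm{SP}(A)=\epsilon$; if $v$ is on no arrow, $\mathrm{SP}(A)=H\cdot\mathrm{SP}(A_{V-\{v\}})$; otherwise let $w=\min\{x\in V:(x,v)\in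 A\}$ and $\mathrm{SP}(A)=U\cdot\mathrm{SP}(A_{V\cap(v,w]})\cdot D\cdot\mathrm{SP}(A_{V-(v,w]})$. Twisting: if $A$ is a digraph on $V$ containing the forward arrow $(v,w)$ with $v=\min V$, $w=\max V$, then $\mathrm{tw}(A)$ is the digraph on $V-\{v\}$ with arrows $A_{V-\{v\}}\cup\{(w,z):(v,z)\in A\}$. $\mathrm{DP}$: for a valid digraph $A$ on $V$: if $A$ has no forward arrow, $\mathrm{DP}(A)=\mathrm{SP}(A)$; otherwise let $(x,y)$ be the forward arrow nesting all other forward arrows, $v=\min V$, $w=\max V$, and $\mathrm{DP}(A)=\mathrm{SP}(A_{V\cap[v,x]})\cdot D\cdot\mathrm{DP}(\mathrm{tw}(A_{V\cap[x,y]}))\cdot U\cdot\mathrm{SP}(A_{V\cap[y,w]})$. *)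

(* Defs.v *)
From HB Require Import structures.
From mathcomp Require Import all_boot finmap.

Set Implicit Arguments.
Unset Strict Implicit.
Unset Printing Implicit Defensive.

Local Open Scope fset_scope.

(* An arrow is the pair (tail, head). *)
Definition arrow : Type := (nat * nat)%type.

Definition forward (a : arrow) : bool := a.1 < a.2.
Definition backward (a : arrow) : bool := a.2 < a.1.

Definition lo (a : arrow) : nat := minn a.1 a.2.
Definition hi (a : arrow) : nat := maxn a.1 a.2.
Definition interval (a : arrow) : {fset nat} :=
  [fset z in iota (lo a) (hi a - lo a).+1].

Definition cross (a b : arrow) : bool :=
  [&& lo a < lo b, lo b < hi a & hi a < hi b] ||
  [&& lo b < lo a, lo a < hi b & hi b < hi a].

Definition nests (a b : arrow) : bool := interval b `<=` interval a.

Definition digraph_on (V : {fset nat}) (A : {fset nat * nat}) : Prop :=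
  {in A, forall a : arrow, [&& a.1 \in V, a.2 \in V & a.1 != a.2]}.

(* In the last clause a = b is harmless: an arrow is not a loop. *)
Definition valid (V : {fset nat}) (A : {fset nat * nat}) : Prop :=
  digraph_on V A /\
  [/\ {in A &, forall a b : arrow, ~~ cross a b},
      {in A &, forall a b : arrow,
         forward a -> forward b -> nests a b || nests b a},
      {in A &, forall a b : arrow, backward a -> forward b -> ~~ nests a b}
    & {in A &, forall a b : arrow, a.2 != b.1}].

Definition restr (A : {fset nat * nat}) (W : {fset nat}) : {fset nat * nat} :=
  [fset a in A | (a.1 \in W) && (a.2 \in W)].

(* Junk value 0 on the empty set. *)
Definition fmin (V : {fset nat}) : nat := head 0 (sort leq V).
Definition fmax (V : {fset nat}) : nat := \max_(x <- V) x.

Inductive letter := U | D | H.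

Definition letter_code (l : letter) : option bool :=
  match l with U => Some true | D => Some false | H => None end.
Definition letter_decode (o : option bool) : letter :=
  match o with Some true => U | Some false => D | None => H end.
Lemma letter_codeK : cancel letter_code letter_decode.
Proof. by case. Qed.
HB.instance Definition _ := Equality.copy letter (can_type letter_codeK).

Definition word := seq letter.

Definition letter_len (l : letter) : nat := if l is H then 2 else 1.
Definition word_len (w : word) : nat := sumn (map letter_len w).

Definition balanced_delannoy (n : nat) (w : word) : Prop :=
  word_len w = 2 * n /\ count_mem U w = count_mem D w.

(* SP and DP recurse on strictly smaller node sets; the recursion is bounded
   by a fuel k, started at the number of nodes, which never runs out on the
   digraphs of interest: see SP_single, SP_H, SP_U and DP_SP, DP_twist below,
   which are the defining equations. *)
Fixpoint SP_rec (k : nat) (V : {fset nat}) (A : {fset nat * nat}) : word :=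
  if k is k'.+1 then
    let v := fmin V in
    if V == [fset v] then [::]
    else if ~~ has (fun a : arrow => (a.1 == v) || (a.2 == v)) A then
      H :: SP_rec k' (V `\ v) (restr A (V `\ v))
    else
      let w := fmin [fset x in V | (x, v) \in A] in
      let W := [fset x in V | v < x <= w] in
      let W' := [fset x in V | ~~ (v < x <= w)] in
      U :: SP_rec k' W (restr A W) ++ D :: SP_rec k' W' (restr A W')
  else [::].

Definition SP (V : {fset nat}) (A : {fset nat * nat}) : word :=
  SP_rec #|` V| V A.

(* If (v, w) is in A, then z = w would give the loop (w, w), which is not an
   arrow: the arrow (v, w) is dropped by the twist. *)
Definition tw (V : {fset nat}) (A : {fset nat * nat}) : {fset nat * nat} :=
  let v := fmin V in
  let w := fmax V in
  restr A (V `\ v) `|`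
  [fset (w, z) | z in [fset z in V | ((v, z) \in A) && (z != w)]].

Definition outermost (A : {fset nat * nat}) (a : arrow) : bool :=
  [&& a \in A, forward a & all (fun b => forward b ==> nests a b) A].

(* Junk value (0, 0) if there is no outermost forward arrow. *)
Definition outer (A : {fset nat * nat}) : arrow :=
  head (0, 0) (filter (outermost A) A).

Fixpoint DP_rec (k : nat) (V : {fset nat}) (A : {fset nat * nat}) : word :=
  if k is k'.+1 then
    if has forward A then
      let x := (outer A).1 in
      let y := (outer A).2 in
      let Wl := [fset z in V | z <= x] in
      let Wm := [fset z in V | x <= z <= y] in
      let Wr := [fset z in V | y <= z] in
      SP Wl (restr A Wl) ++
      D :: DP_rec k' (Wm `\ fmin Wm) (tw Wm (restr A Wm)) ++
      U :: SP Wr (restr A Wr)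
    else SP V A
  else [::].

Definition DP (V : {fset nat}) (A : {fset nat * nat}) : word :=
  DP_rec #|` V| V A.

Lemma in_interval a z : (z \in interval a) = (lo a <= z <= hi a).
Proof.
have -> : (z \in interval a) = (z \in iota (lo a) (hi a - lo a).+1) by rewrite in_fset.
rewrite mem_iota addnS ltnS subnKC //.
by rewrite /lo /hi (leq_trans (geq_minl _ _)) ?leq_maxl.
Qed.

Lemma lo_hi a : lo a <= hi a.
Proof. by rewrite /lo /hi (leq_trans (geq_minl _ _)) ?leq_maxl. Qed.

Lemma nestsE a b : nests a b = (lo a <= lo b) && (hi b <= hi a).
Proof.
apply/fsubsetP/andP => [sub|[l h] z].
  have := sub (lo b); have := sub (hi b).
  by rewrite !in_interval !leqnn !lo_hi /= => /(_ isT)/andP[_ ->] /(_ isT)/andP[-> _].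
rewrite !in_interval => /andP[lz zh].
by rewrite (leq_trans l lz) (leq_trans zh h).
Qed.

Lemma in_restr A W a :
  (a \in restr A W) = [&& a \in A, a.1 \in W & a.2 \in W].
Proof. by rewrite !inE. Qed.

Lemma fmin_in V : V != fset0 -> fmin V \in V.
Proof.
move=> V0; rewrite -(mem_sort leq) /fmin.
case E: (sort leq V) => [|a s] /=; last by rewrite mem_head.
case/fset0Pn: V0 => x; by rewrite -(mem_sort leq) E.
Qed.

Lemma fmin_le V x : x \in V -> fmin V <= x.
Proof.
rewrite -(mem_sort leq) /fmin.
have := sort_sorted leq_total (V : seq nat).
case: (sort leq V) => [|a s] //= sa.
rewrite inE => /orP[/eqP->//|xs].
by move/allP: (order_path_min leq_trans sa) => /(_ _ xs).
Qed.

Lemma fmax_le (V : {fset nat}) x : x \in V -> x <= fmax V.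
Proof. by move=> xV; apply: (@leq_bigmax_seq nat (enum_fset V) predT id). Qed.

Lemma fmax_in V : V != fset0 -> fmax V \in V.
Proof.
case/fset0Pn=> x xV; rewrite /fmax big_seq.
have : (\max_(i <- V | i \in V) i == 0) || (\max_(i <- V | i \in V) i \in V).
  apply: (big_ind (fun m => (m == 0) || (m \in V))) => // [m p|i ->].
    by rewrite /maxn; case: ifP.
  by rewrite orbT.
case/orP=> // /eqP E.
have : x <= 0 by rewrite -E -big_seq; apply: fmax_le.
by rewrite leqn0 => /eqP x0; rewrite E -x0.
Qed.

Lemma digraph_on_restr V W A : digraph_on V A -> digraph_on W (restr A W).
Proof.
move=> dA a; rewrite in_restr => /and3P[aA a1 a2].
by case/and3P: (dA a aA) => _ _ ne; rewrite a1 a2.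
Qed.

Lemma backward_restr W A :
  {in A, forall a, backward a} -> {in restr A W, forall a, backward a}.
Proof. by move=> bA a; rewrite in_restr => /and3P[/bA]. Qed.

Lemma fcard_lt (V W : {fset nat}) x :
  {subset W <= V} -> x \in V -> x \notin W -> #|` W| < #|` V|.
Proof.
move=> /fsubsetP sWV xV xW; apply: fproper_ltn_card.
by rewrite fproperE sWV; apply/fsubsetPn; exists x.
Qed.

Section SPTheory.
Variables (V : {fset nat}) (A : {fset nat * nat}).
Hypothesis dA : digraph_on V A.
Hypothesis bA : {in A, forall a, backward a}.
Let v := fmin V.
Let w := fmin [fset x in V | (x, v) \in A].

Lemma SP_head : has (fun a : arrow => (a.1 == v) || (a.2 == v)) A ->
  [/\ w \in V, (w, v) \in A & v < w].
Proof.
case/hasP=> -[a b] abA /= /orP abv.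
have /and3P[/= aV bV _] := dA abA.
have ltba : b < a := bA abA.
have bv : b = v.
  case: abv => /eqP // av; move: ltba; rewrite av ltnNge => /negP[].
  exact: fmin_le.
have : w \in [fset x in V | (x, v) \in A].
  by apply: fmin_in; apply/fset0Pn; exists a; rewrite !inE /= aV -bv.
by rewrite !inE /= => /andP[wV wA]; split=> //; apply: bA wA.
Qed.
End SPTheory.

Lemma SP_rec_fuel k k' V A :
  digraph_on V A -> {in A, forall a, backward a} -> V != fset0 ->
  #|` V| <= k -> #|` V| <= k' -> SP_rec k V A = SP_rec k' V A.
Proof.
have pos (V0 : {fset nat}) : V0 != fset0 -> 0 < #|` V0| by rewrite cardfs_gt0.
elim: k k' V A => [|k IH] [|k'] V A dA bA V0 hk hk' //=.
- by move: (leq_trans (pos _ V0) hk).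
- by move: (leq_trans (pos _ V0) hk').
have vV := fmin_in V0.
have rec W : W != fset0 -> #|` W| < #|` V| ->
    SP_rec k W (restr A W) = SP_rec k' W (restr A W).
  move=> W0 ltW; apply: IH => //.
  - exact: digraph_on_restr dA.
  - exact: backward_restr.
  - by rewrite -ltnS (leq_trans ltW).
  - by rewrite -ltnS (leq_trans ltW).
case: ifP => // /negbT Vv; case: ifP => [_|/negbFE hv].
  congr (_ :: _); apply: rec.
    apply: contra Vv; rewrite fsetD_eq0 => sV.
    by rewrite eqEfsubset sV fsub1set.
  by apply: (@fcard_lt _ _ (fmin V)) => // [x|]; rewrite !inE ?eqxx // => /andP[].
have [wV _ ltvw] := SP_head dA bA hv.
congr (_ :: _ ++ _ :: _); apply: rec.
- apply/fset0Pn; exists (fmin [fset x in V | (x, fmin V) \in A]).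
  by rewrite !inE /= wV ltvw leqnn.
- by apply: (@fcard_lt _ _ (fmin V)) => // [x|]; rewrite !inE /= ?ltnn ?andbF // => /andP[].
- by apply/fset0Pn; exists (fmin V); rewrite !inE /= vV ltnn.
- apply: (@fcard_lt _ _ _ _ wV) => [x|]; rewrite !inE /=.
    by case/andP.
  by rewrite ltvw leqnn andbF.
Qed.

Lemma SP_single v A : SP [fset v] A = [::].
Proof.
rewrite /SP cardfs1 /= (_ : fmin [fset v] = v) ?eqxx //.
by apply/eqP; rewrite -in_fset1 fmin_in //; apply/fset0Pn; exists v; rewrite inE.
Qed.

Section SPEquations.
Variables (V : {fset nat}) (A : {fset nat * nat}).
Hypothesis dA : digraph_on V A.
Hypothesis bA : {in A, forall a, backward a}.
Hypothesis V_gt1 : 1 < #|` V|.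
Let v := fmin V.
Let w := fmin [fset x in V | (x, v) \in A].
Let W := [fset x in V | v < x <= w].
Let W' := [fset x in V | ~~ (v < x <= w)].

Let V0 : V != fset0.
Proof. by rewrite -cardfs_gt0 ltnW. Qed.

Let Vv : V != [fset v].
Proof. by apply/eqP => E; have := V_gt1; rewrite E cardfs1. Qed.

Let SP_fuel k W0 : W0 != fset0 -> #|` W0| <= k ->
  SP_rec k W0 (restr A W0) = SP W0 (restr A W0).
Proof.
move=> nz le; apply: SP_rec_fuel => //; first exact: digraph_on_restr dA.
exact: backward_restr.
Qed.

Lemma SP_H : ~~ has (fun a : arrow => (a.1 == v) || (a.2 == v)) A ->
  SP V A = H :: SP (V `\ v) (restr A (V `\ v)).
Proof.
have vV : v \in V by exact: fmin_in.
have c := cardfsD1 v V; rewrite vV add1n in c.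
move=> nv; rewrite {1}/SP c /= (negbTE Vv) nv SP_fuel //.
by rewrite -cardfs_gt0 -ltnS -c.
Qed.

Lemma SP_U : has (fun a : arrow => (a.1 == v) || (a.2 == v)) A ->
  SP V A = U :: SP W (restr A W) ++ D :: SP W' (restr A W').
Proof.
have vV : v \in V by exact: fmin_in.
move=> hv; have [wV _ ltvw] := SP_head dA bA hv.
rewrite {1}/SP; case c: #|` V| => [|k] /=; first by have := V_gt1; rewrite c.
rewrite (negbTE Vv) hv /=.
rewrite -/v -/w -/W -/W' !SP_fuel //.
- by apply/fset0Pn; exists v; rewrite !inE /= vV ltnn.
- rewrite -ltnS -c; apply: (@fcard_lt _ _ _ _ wV) => [x|]; rewrite !inE /=.
    by case/andP.
  by rewrite ltvw leqnn andbF.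
- by apply/fset0Pn; exists w; rewrite !inE /= wV ltvw leqnn.
- rewrite -ltnS -c; apply: (@fcard_lt _ _ _ _ vV) => [x|]; rewrite !inE /=.
    by case/andP.
  by rewrite ltnn andbF.
Qed.
End SPEquations.

Lemma outermost_outer A a : outermost A a -> outer A = a.
Proof.
move=> oa; have : a \in filter (outermost A) A.
  by rewrite mem_filter oa; case/and3P: oa.
rewrite /outer; case E: (filter _ _) => [|b s] //= _.
have : b \in filter (outermost A) A by rewrite E mem_head.
rewrite mem_filter => /andP[/and3P[bA fb /allP nb] _].
case/and3P: oa => aA fa /allP na.
move: (nb a aA) (na b bA); rewrite fa fb /= !nestsE.
rewrite /lo /hi /minn /maxn; move: fa fb; rewrite /forward => -> ->.
move=> /andP[l1 h1] /andP[l2 h2]; case: a b l1 h1 l2 h2 {na nb aA bA E} => a1 a2 [b1 b2] /=.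
by move=> *; congr (_, _); apply/eqP; rewrite eqn_leq; apply/andP.
Qed.

Lemma digraph_on_tw V A : digraph_on V A -> digraph_on (V `\ fmin V) (tw V A).
Proof.
move=> dA a; rewrite /tw in_fsetU => /orP[|].
  by move/(digraph_on_restr (W := V `\ fmin V) dA).
case/imfsetP=> z; rewrite in_fset => /and3P[zV vzA zw] ->.
have /and3P[/= vV _ vz] := dA _ vzA.
have wV : fmax V \in V by apply: fmax_in; apply/fset0Pn; exists z.
have vlz : fmin V < z by rewrite ltn_neqAle vz fmin_le.
have vlw : fmin V < fmax V by rewrite (leq_trans vlz) // fmax_le.
by rewrite /= !inE wV zV (gtn_eqF vlw) (gtn_eqF vlz) /= eq_sym.
Qed.

Lemma DP_rec_fuel k k' V A : digraph_on V A ->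
  #|` V| <= k -> #|` V| <= k' -> DP_rec k V A = DP_rec k' V A.
Proof.
have base k0 A0 : digraph_on fset0 A0 -> DP_rec k0 fset0 A0 = [::].
  move=> d0; case: k0 => //= k0; rewrite ifN; first by rewrite /SP cardfs0.
  by apply/hasPn => a /d0; rewrite !inE.
elim: k k' V A => [|k IH] [|k'] V A dA hk hk' //.
- by move: hk; rewrite leqn0 cardfs_eq0 => /eqP V0; rewrite V0 in dA *; rewrite !base.
- by move: hk'; rewrite leqn0 cardfs_eq0 => /eqP V0; rewrite V0 in dA *; rewrite !base.
rewrite /=; case: ifP => // /hasP[a aA _].
set Wm := [fset z in V | _ <= z <= _]; congr (_ ++ _ :: _ ++ _).
suff ltm : #|` Wm `\ fmin Wm| < #|` V|.
  apply: IH.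
  - by apply: digraph_on_tw; apply: digraph_on_restr dA.
  - by rewrite -ltnS; apply: leq_trans ltm hk.
  - by rewrite -ltnS; apply: leq_trans ltm hk'.
have sub : {subset Wm <= V} by move=> x; rewrite !inE => /andP[].
have [Wm0|nz] := eqVneq Wm fset0.
  rewrite Wm0 fset0D cardfs0 cardfs_gt0; apply/fset0Pn; exists a.1.
  by case/and3P: (dA a aA).
have mW := fmin_in nz.
apply: (@fcard_lt _ _ (fmin Wm)) => [x||]; last by rewrite !inE eqxx.
  by rewrite in_fsetD => /andP[_ /sub].
exact: sub.
Qed.

Lemma DP_SP V A : digraph_on V A -> ~~ has forward A -> DP V A = SP V A.
Proof.
by move=> dA nf; rewrite /DP /SP; case E: #|` V| => [|k] //=; rewrite (negbTE nf) /SP E.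
Qed.

Lemma DP_twist V A x y : digraph_on V A -> outermost A (x, y) ->
  let Wl := [fset z in V | z <= x] in
  let Wm := [fset z in V | x <= z <= y] in
  let Wr := [fset z in V | y <= z] in
  DP V A = SP Wl (restr A Wl) ++
    D :: DP (Wm `\ x) (tw Wm (restr A Wm)) ++ U :: SP Wr (restr A Wr).
Proof.
move=> dA oxy Wl Wm Wr; case/and3P: (oxy) => xyA fxy _.
have /and3P[/= xV yV _] := dA _ xyA.
have ltxy : x < y by [].
have hf : has forward A by apply/hasP; exists (x, y).
have xW : x \in Wm by rewrite !inE /= xV leqnn ltnW.
have mx : fmin Wm = x.
  apply/eqP; rewrite eqn_leq fmin_le //=.
  have : fmin Wm \in Wm by apply: fmin_in; apply/fset0Pn; exists x.
  by rewrite !inE => /and3P[].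
have ltm : #|` Wm `\ x| < #|` V|.
  apply: (@fcard_lt _ _ x) => // [z|]; rewrite !inE ?eqxx //.
  by case/and3P.
rewrite {1}/DP; case c: #|` V| ltm => [|k] //= ltm.
rewrite hf (outermost_outer oxy) /= -/Wl -/Wm -/Wr mx.
congr (_ ++ _ :: _ ++ _); apply: DP_rec_fuel => //.
by rewrite -{1}mx; apply: digraph_on_tw; apply: digraph_on_restr dA.
Qed.

(* Main.v *)
(* In a valid digraph with a forward arrow, let (x, y) be the outermost one and
   v, w the least and greatest nodes.
   Every other arrow lies within [v, x], within [x, y] or within [y, w], and the
   arrows of the outer two parts are backward. On [x, y] the twist is
   invertible: y has no outgoing arrow before it, so the arrows leaving y after
   it are exactly the twisted ones. Hence valid digraphs with a forward arrow
   correspond to triples (backward digraph, valid digraph, backward digraph) on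
   smaller node sets. On the word side, a balanced word that dips below the axis
   factors uniquely as a D d U c with a and c Schroeder words: cut at the first
   descent to height -1 and at the last ascent from it. The first-return
   decomposition of Schroeder words matches the recursion of SP in the same way,
   and the lengths of the factors determine x, y (resp. w) by counting nodes. *)

Require Import Defs.
From mathcomp Require Import all_boot finmap classical_sets functions.
From mathcomp Require Import zify.

Set Implicit Arguments.
Unset Strict Implicit.
Unset Printing Implicit Defensive.

Local Open Scope fset_scope.
Local Open Scope nat_scope.

(** * Balanced words *)

(* Unlike count_mem, a head constant that simplification leaves folded, so that
   equal counts stay syntactically equal. *)
Definition countl (l : letter) (s : word) : nat := count_mem l s.

Lemma countl_nil l : countl l [::] = 0.
Proof. by []. Qed.

Lemma countl_cons l x s : countl l (x :: s) = (x == l) + countl l s.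
Proof. by []. Qed.

Lemma countl_cat l s t : countl l (s ++ t) = countl l s + countl l t.
Proof. exact: count_cat. Qed.

Definition countlE := (countl_cons, countl_cat, countl_nil).
Arguments countl : simpl never.

Definition nonneg_prefixes (s : word) : Prop :=
  forall p q, s = p ++ q -> countl D p <= countl U p.

(** Read from its end, the path stays weakly above its final height. For balanced words this is the
    Schröder condition again, in the form that suits the last ascent. *)
Definition nonpos_suffixes (s : word) : Prop :=
  forall p q, s = p ++ q -> countl U q <= countl D q.

(** With as many [D] as [U], the length is twice the number of letters [U] and [H], so [n] is the
    half-length. *)
Definition delannoy (n : nat) (s : word) : Prop :=
  countl U s = countl D s /\ countl U s + countl H s = n.

Definition schroder (n : nat) (s : word) : Prop :=
  nonneg_prefixes s /\ delannoy n s.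

Lemma word_lenE s :
  word_len s = countl U s + countl D s + 2 * countl H s.
Proof.
elim: s => // -[] s IH; rewrite /word_len /= in IH *;
  by rewrite {}IH !countlE /=; lia.
Qed.

Lemma balanced_delannoyE n s : balanced_delannoy n s <-> delannoy n s.
Proof. by rewrite /balanced_delannoy /delannoy word_lenE -!/(countl _ s); lia. Qed.

Lemma delannoy_inj m n s : delannoy m s -> delannoy n s -> m = n.
Proof. by move=> [_ <-] [_ <-]. Qed.

Lemma schroder_suffixes n s : schroder n s -> nonpos_suffixes s.
Proof.
move=> [up [bal _]] p q E; move: (up _ _ E) bal.
by rewrite E !countlE; lia.
Qed.

Lemma suffixes_schroder n s :
  nonpos_suffixes s -> delannoy n s -> schroder n s.
Proof.
move=> dn [bal bn]; split=> // p q E; move: (dn _ _ E) bal.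
by rewrite E !countlE; lia.
Qed.

(** * Cutting words at the first descent and the last ascent *)

Lemma cat_eq_cat (T : Type) (a b c d : seq T) : a ++ b = c ++ d ->
  (exists t, c = a ++ t /\ b = t ++ d) \/ (exists t, a = c ++ t /\ d = t ++ b).
Proof.
elim: a c => [|x a IH] [|y c] /=.
- by move=> ->; left; exists [::].
- by move=> ->; left; exists (y :: c).
- by move=> <-; right; exists (x :: a).
by case=> -> /IH [[t [-> ->]]|[t [-> ->]]]; [left|right]; exists t.
Qed.

(** If one Schröder factor were strictly longer, it would have the other one followed by [D] as a
    prefix, and that prefix ends at height -1. *)
Lemma first_descent_uniq m n a b a' b' : schroder m a -> schroder n a' ->
  a ++ D :: b = a' ++ D :: b' -> a = a' /\ b = b'.
Proof.
have aux i j x y x' y' t : schroder i x -> schroder j x' -> x' = x ++ t ->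
    D :: y = t ++ D :: y' -> x = x' /\ y = y'.
  move=> [_ [bx _]] [up' _] Ex; rewrite {}Ex in up' *; case: t up' => [|l t] up' E.
    by case: E => ->; rewrite cats0.
  case: E up' => <- _ up'; exfalso; have := up' (rcons x D) t.
  rewrite cat_rcons => /(_ erefl).
  by rewrite -cats1 !countlE /= bx; lia.
move=> sa sa' /cat_eq_cat[[t [E F]]|[t [E F]]].
  exact: aux sa sa' E F.
by have [-> ->] := aux _ _ _ _ _ _ _ sa' sa E F.
Qed.

Lemma last_ascent_uniq m n b c b' c' : schroder m c -> schroder n c' ->
  b ++ U :: c = b' ++ U :: c' -> b = b' /\ c = c'.
Proof.
have aux i j x y x' y' t : schroder i y -> schroder j y' -> x' = x ++ t ->
    U :: y = t ++ U :: y' -> x = x' /\ y = y'.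
  move=> /schroder_suffixes dn [_ [by' _]] ->; case: t => [|l t] E.
    by case: E => ->; rewrite cats0.
  by exfalso; case: E => _ /dn; rewrite !countlE /= by'; lia.
move=> sc sc' /cat_eq_cat[[t [E F]]|[t [E F]]].
  exact: aux sc sc' E F.
by have [-> ->] := aux _ _ _ _ _ _ _ sc' sc E F.
Qed.

(** Induction on the right end: the first letter that breaks nonnegativity must be a [D] appended at
    height 0, so the word before it is balanced. *)
Lemma first_descent s : nonneg_prefixes s \/
  exists n a b, s = a ++ D :: b /\ schroder n a.
Proof.
elim/last_ind: s => [|s l IH]; first by left=> -[|? ?] [|? ?].
case: IH => [up|[n [a [b [-> sa]]]]]; last first.
  by right; exists n, a, (rcons b l); rewrite rcons_cat.
have up_s := up s [::] (esym (cats0 s)).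
have [le|gt] := leqP (countl D (rcons s l)) (countl U (rcons s l)).
  left=> p q; case/lastP: q => [|q l'] E; first by rewrite cats0 in E; rewrite -E.
  by move: E; rewrite -rcons_cat => /rcons_inj[E _]; exact: up E.
right; exists (countl U s + countl H s), s, [::].
move: gt; rewrite -cats1 !countlE /=; case: l => /= gt; try by exfalso; lia.
by split=> //; split=> //; split=> //; lia.
Qed.

(** Mirror image of [first_descent], by induction on the left end: the letter that breaks the
    condition is a [U] put before a balanced suffix. *)
Lemma last_ascent s : nonpos_suffixes s \/
  exists n b c, s = b ++ U :: c /\ schroder n c.
Proof.
elim: s => [|l s IH]; first by left=> -[|? ?] [|? ?].
case: IH => [dn|[n [b [c [-> sc]]]]]; last by right; exists n, (l :: b), c.
have dn_s := dn [::] s erefl.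
have [le|gt] := leqP (countl U (l :: s)) (countl D (l :: s)).
  left=> -[|l' p] q /= E; first by rewrite -E.
  by case: E => _; exact: dn.
right; exists (countl U s + countl H s), [::], s.
move: gt; rewrite !countlE; case: l => /= gt; try by exfalso; lia.
split=> //; by apply: suffixes_schroder => //; split => //; lia.
Qed.

Lemma schroder_nil n : schroder n [::] <-> n = 0.
Proof. by split=> [[_ []]//|->]; split=> // -[|? ?] [|? ?]. Qed.

Lemma schroder_H n s : schroder n (H :: s) <-> 0 < n /\ schroder n.-1 s.
Proof.
split=> [[up [bal bn]]|[n0 [up [bal bn]]]].
  split; first by move: bn; rewrite !countlE /=; lia.
  split; last by move: bal bn; rewrite /delannoy !countlE /=; lia.
  by move=> p q E; apply: (up (H :: p) q); rewrite /= E.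
split; last by move: bal bn; rewrite /delannoy !countlE /=; lia.
by case=> [|l p] q //= [<-]; apply: up.
Qed.

Lemma schroder_glue m n a b : schroder m a -> schroder n b ->
  schroder (m + n).+1 (U :: a ++ D :: b).
Proof.
move=> [upa [bala bna]] [upb [balb bnb]]; split; last first.
  by rewrite /delannoy /= !countlE /=; lia.
(* The cut falls at the end of [a], past the [D], or inside [a]. *)
case=> [|l p] q //= [<-] /cat_eq_cat[[[|l' t] [-> E]]|[t [E _]]].
- by rewrite cats0 !countlE /=; lia.
- by case: E => <- /upb; rewrite !countlE /=; lia.
- by have := upa p t E; rewrite !countlE /=; lia.
Qed.

(** First-return decomposition. After a leading [U] the rest of the word ends one below its start,
    so it has a first descent; this is where the whole word returns to the axis. *)
Lemma schroder_split n s : schroder n s ->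
  [\/ s = [::], exists t, s = H :: t |
   exists m k a b, [/\ s = U :: a ++ D :: b, schroder m a, schroder k b
     & n = (m + k).+1]].
Proof.
case: s => [|[] s] ss; [by apply: Or31| |exfalso|by apply: Or32; exists s].
  apply: Or33; case: (ss) => [up [bal bn]].
  case: (first_descent s) => [up'|[m [a [b [E [upa [bala bna]]]]]]].
    by have := up' s [::] (esym (cats0 s)); move: bal; rewrite !countlE /=; lia.
  exists m, (n - m.+1), a, b; rewrite {}E in up bal bn *.
  rewrite !countlE /= in bal bn.
  split=> //; last lia.
  split; last by split; lia.
  (* The factor [U a D] has net height 0, so prefixes of [b] inherit nonnegativity from prefixes of
     the whole word. *)
  move=> p q E; have := up (U :: a ++ D :: p) q.
  by rewrite E /= -catA => /(_ erefl); rewrite !countlE /=; lia.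
by case: ss => up _; have := up [:: D] s erefl.
Qed.

Lemma delannoy_glue i j k a d c :
  schroder i a -> delannoy j d -> schroder k c ->
  delannoy (i + j + k).+1 (a ++ D :: d ++ U :: c).
Proof.
by move=> [_ []] + + [+ +] [_ [+ +]]; rewrite /delannoy !countlE /=; lia.
Qed.

Lemma delannoy_glue_not_schroder n i a b :
  schroder i a -> schroder n (a ++ D :: b) -> False.
Proof.
move=> [_ [bal _]] [up _]; have := up (rcons a D) b; rewrite cat_rcons => /(_ erefl).
by rewrite -cats1 !countlE /=; lia.
Qed.

(** If the word has a first descent, the part [b] after it rises by one in total. Hence [b] itself
    violates [nonpos_suffixes] and has a last ascent; what remains between is balanced but otherwise
    arbitrary. *)
Lemma delannoy_split n s : delannoy n s -> schroder n s \/
  exists i j k a d c, [/\ s = a ++ D :: d ++ U :: c,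
    schroder i a, delannoy j d, schroder k c & n = (i + j + k).+1].
Proof.
move=> [bal bn]; case: (first_descent s) => [up|[i [a [b [E sa]]]]]; first by left.
right; case: (sa) => [_ [bala bna]].
case: (last_ascent b) => [dn|[k [d [c [Eb sc]]]]].
  by have := dn [::] b erefl; move: bal; rewrite E !countlE /=; lia.
exists i, (n - (i + k).+1), k, a, d, c; case: (sc) => [_ [balc bnc]].
move: bal bn; rewrite E Eb !countlE /= => bal bn.
by split=> //; rewrite /delannoy; lia.
Qed.

(** * Compatible arrows *)

(** All four clauses of validity constrain ordered pairs of arrows, so they merge into one relation.
    It is not symmetric, and proofs often need it in both orders. *)
Definition compat (a b : arrow) : bool :=
  [&& ~~ cross a b, forward a && forward b ==> nests a b || nests b a,
      backward a && forward b ==> ~~ nests a b & a.2 != b.1].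

Lemma validE V A : valid V A <->
  digraph_on V A /\ (forall a b, a \in A -> b \in A -> compat a b).
Proof.
split=> [[dA [h1 h2 h3 h4]]|[dA h]]; split=> //.
  move=> a b aA bA.
  by apply/and4P; split; [exact: h1|apply/implyP => /andP[]; exact: h2
    |apply/implyP => /andP[]; exact: h3|exact: h4].
split=> a b aA bA; case/and4P: (h a b aA bA) => // _ h2 h3 _ fa fb.
  by apply: (implyP h2); rewrite fa.
by apply: (implyP h3); rewrite fa.
Qed.

(** Once the directions are known, compatibility is a set of inequalities between endpoints, ready
    for [lia]. For two forward arrows nesting subsumes non-crossing. Loops are not excluded here,
    hence the guard [b < a]. *)
Lemma compatE (a b c d : nat) : compat (a, b) (c, d) =
  (b != c) && if a < b then
    if c < d then (a <= c) && (d <= b) || (c <= a) && (b <= d)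
    else ~~ [&& a < d, d < b & b < c] && ~~ [&& d < a, a < c & c < b]
  else if c < d then
    [&& ~~ [&& b < c, c < a & a < d], ~~ [&& c < b, b < d & d < a]
      & (b < a) ==> ~~ ((b <= c) && (d <= a))]
  else ~~ [&& b < d, d < a & a < c] && ~~ [&& d < b, b < c & c < a].
Proof.
rewrite /compat /cross !nestsE /lo /hi /forward /backward /=.
rewrite (andbC (_ != _)) !andbA; congr andb.
by case: (ltngtP a b); case: (ltngtP c d) => //=; lia.
Qed.

Definition bvalid (V : {fset nat}) (A : {fset nat * nat}) : Prop :=
  valid V A /\ {in A, forall a, backward a}.

Lemma valid_arrow V A (a b : nat) : valid V A -> (a, b) \in A ->
  [/\ a \in V, b \in V & a != b].
Proof. by case=> dA _ /dA /and3P[]. Qed.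

Lemma valid_compat V A a b : valid V A -> a \in A -> b \in A -> compat a b.
Proof. by move=> /validE[_]; apply. Qed.

Lemma valid_restr V W A : valid V A -> valid W (restr A W).
Proof.
move=> /validE[dA h]; apply/validE; split; first exact: digraph_on_restr dA.
by move=> a b; rewrite !in_restr => /and3P[aA _ _] /and3P[bA _ _]; apply: h.
Qed.

Lemma bvalid_restr V W A : bvalid V A -> bvalid W (restr A W).
Proof. by move=> [vA bA]; split; [exact: valid_restr vA | exact: backward_restr]. Qed.

Lemma valid_widen (V W : {fset nat}) A :
  {subset W <= V} -> valid W A -> valid V A.
Proof.
move=> sWV [dA hA]; split=> // a aA; case/and3P: (dA a aA) => a1 a2 ->.
by rewrite !sWV.
Qed.

Lemma restr_id W A : digraph_on W A -> restr A W = A.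
Proof.
move=> dA; apply/fsetP => a; rewrite in_restr.
by case aA: (a \in A) => //=; case/and3P: (dA a aA) => -> ->.
Qed.

(** * Counting nodes *)

(** Remove the maximum until [k] nodes are left. This turns the half-length of a factor of a word
    into a node. *)
Lemma exists_rank (V : {fset nat}) k : 0 < k <= #|` V| ->
  exists2 w : nat, w \in V & #|` [fset z in V | z <= w]| = k.
Proof.
move En: #|` V| => n; elim: n V En => [|n IH] V En kn; first lia.
have V0 : V != fset0 by rewrite -cardfs_gt0 En.
have mV := fmax_in V0.
have [->|kn1] := eqVneq k n.+1.
  exists (fmax V) => //; rewrite -En; congr #|` _|; apply/fsetP=> z.
  by rewrite !inE /=; case zV: (z \in V) => //=; rewrite fmax_le.
have c := cardfsD1 (fmax V) V; rewrite mV En in c.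
have [] := IH (V `\ fmax V); [lia|lia|] => w; rewrite !inE => /andP[wm wV] <-.
exists w => //; congr #|` _|; apply/fsetP=> z; rewrite !inE /=.
have [->|] //= := eqVneq z (fmax V).
by rewrite mV /=; have := fmax_le wV; lia.
Qed.

Lemma card_le_ge (V : {fset nat}) y : y \in V ->
  #|` [fset z in V | z <= y]| + #|` [fset z in V | y <= z]| = #|` V|.+1.
Proof.
move=> yV; rewrite -cardfsUI -addn1; congr (_ + _).
  congr #|` _|; apply/fsetP=> z; rewrite !inE /= -andb_orr leq_total.
  by rewrite andbT.
rewrite -(cardfs1 y); congr #|` _|; apply/fsetP=> z; rewrite !inE /=.
by rewrite andbACA andbb -eqn_leq; have [->|] := eqVneq z y; rewrite ?yV ?andbF.
Qed.

(** The middle part loses [x], just as the twist deletes it, so the two parts are disjoint. *)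
Lemma card_le_between (V : {fset nat}) x y : x <= y -> x \in V ->
  #|` [fset z in V | z <= x]| + #|` [fset z in V | x <= z <= y] `\ x| =
  #|` [fset z in V | z <= y]|.
Proof.
move=> xy xV; rewrite -cardfsUI (_ : _ `&` _ = fset0) ?cardfs0 ?addn0.
  congr #|` _|; apply/fsetP=> z; rewrite !inE /=.
  by case: (z \in V) => //=; lia.
by apply/fsetP=> z; rewrite !inE /=; case: (z \in V) => //=; lia.
Qed.

Lemma card_above_min (V : {fset nat}) w : w \in V ->
  #|` [fset z in V | fmin V < z <= w]|.+1 = #|` [fset z in V | z <= w]|.
Proof.
move=> wV; have V0 : V != fset0 by apply/fset0Pn; exists w.
have vV := fmin_in V0; have vw := fmin_le wV.
rewrite (cardfsD1 (fmin V) [fset z in V | z <= w]) !inE /= vV vw add1n; congr _.+1.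
congr #|` _|; apply/fsetP=> z; rewrite !inE /=.
by case zV: (z \in V); rewrite ?andbF //=; have := fmin_le zV; lia.
Qed.

Lemma card_split (V : {fset nat}) (P : pred nat) :
  #|` [fset z in V | P z]| + #|` [fset z in V | ~~ P z]| = #|` V|.
Proof.
rewrite -cardfsUI (_ : _ `&` _ = fset0) ?cardfs0 ?addn0.
  by congr #|` _|; apply/fsetP=> z; rewrite !inE /=; case: (z \in V); case: (P z).
by apply/fsetP=> z; rewrite !inE /=; case: (z \in V); case: (P z).
Qed.

Lemma fmin_eq (V : {fset nat}) x :
  x \in V -> {in V, forall z, x <= z} -> fmin V = x.
Proof.
move=> xV le; have V0 : V != fset0 by apply/fset0Pn; exists x.
by apply/eqP; rewrite eqn_leq fmin_le //= le ?fmin_in.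
Qed.

Lemma fmax_eq (V : {fset nat}) x :
  x \in V -> {in V, forall z, z <= x} -> fmax V = x.
Proof.
move=> xV le; have V0 : V != fset0 by apply/fset0Pn; exists x.
by apply/eqP; rewrite eqn_leq le ?fmax_in //= fmax_le.
Qed.

(** * Backward digraphs and Schroeder words *)

Definition on_arrow (A : {fset nat * nat}) (v : nat) : bool :=
  has (fun a : arrow => (a.1 == v) || (a.2 == v)) A.

Lemma bvalid_arrow V A (a b : nat) : bvalid V A -> (a, b) \in A ->
  [/\ a \in V, b \in V & b < a].
Proof. by move=> [vA bA] abA; case: (valid_arrow vA abA) => *; split=> //; exact: bA abA. Qed.

Lemma bvalid_fset1 v A : bvalid [fset v] A -> A = fset0.
Proof.
move=> vA; apply/eqP; rewrite -[_ == _]negbK; apply/negP => /fset0Pn[[a b] /(bvalid_arrow vA)].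
by rewrite !inE => -[/eqP-> /eqP->]; rewrite ltnn.
Qed.

Lemma bvalid_fset0 V : bvalid V fset0.
Proof. by split; [split; [|split]|] => a; rewrite ?inE. Qed.

Lemma compat_backward (a b c d : nat) : b < a -> d < c -> compat (a, b) (c, d) =
  [&& ~~ [&& b < d, d < a & a < c], ~~ [&& d < b, b < c & c < a] & b != c].
Proof.
by move=> /ltnW ba /ltnW dc; rewrite compatE (ltnNge a b) ba (ltnNge c d) dc /= andbC -andbA.
Qed.

Section MinOnNoArrow.
Variables (V : {fset nat}).
Hypothesis V_gt1 : 1 < #|` V|.
Let v := fmin V.

(** No arrow meets [v], so restricting to the other nodes loses nothing and [restr] disappears from
    the recursion. *)
Lemma SP_H_split A : bvalid V A -> ~~ on_arrow A v ->
  bvalid (V `\ v) A /\ SP V A = H :: SP (V `\ v) A.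
Proof.
move=> vA nA; have rA : restr A (V `\ v) = A.
  apply: restr_id => -[a b] abA /=; have [aV bV ltba] := bvalid_arrow vA abA.
  have := hasPn nA _ abA; rewrite negb_or !inE /= aV bV (gtn_eqF ltba).
  by move=> /andP[-> ->].
split; first by rewrite -rA; exact: bvalid_restr vA.
by case: (vA) => -[dA _] bA; rewrite SP_H // -/v rA.
Qed.

Lemma SP_H_glue A : bvalid (V `\ v) A ->
  bvalid V A /\ SP V A = H :: SP (V `\ v) A.
Proof.
move=> vA; have nA : ~~ on_arrow A v.
  apply/hasPn => -[a b] /(bvalid_arrow vA)[] /=.
  by rewrite !inE => /andP[/negPf-> _] /andP[/negPf-> _].
have bvA : bvalid V A.
  case: vA => vA bA; split=> //; apply: valid_widen vA => x.
  by rewrite !inE => /andP[].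
by split=> //; case: (SP_H_split bvA nA).
Qed.
End MinOnNoArrow.

Section MinOnArrow.
Variables (V : {fset nat}).
Hypothesis V_gt1 : 1 < #|` V|.
Let v := fmin V.

(** The minimum belongs to [outside] and [w] to [inner], so both parts are nonempty. Each has one
    node more than the half-length of its word, which makes room for the pair [U], [D]. *)
Definition inner (w : nat) : {fset nat} := [fset x in V | fmin V < x <= w].
Definition outside (w : nat) : {fset nat} :=
  [fset x in V | ~~ (fmin V < x <= w)].

(** Apart from [(w, v)] no arrow joins the two parts: from beyond [w] into the open interval it
    would cross [(w, v)], its head cannot be the tail [w], and an arrow into [v] comes from [w] or
    beyond by minimality of [w]. *)
Lemma SP_U_split A : bvalid V A -> on_arrow A v ->
  exists w, let B := restr A (inner w) in let C := restr A (outside w) in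
  [/\ w \in V, v < w, A = (w, v) |` (B `|` C)
    & SP V A = U :: SP (inner w) B ++ D :: SP (outside w) C].
Proof.
move=> vA hA; case: (vA) => -[dA _] bA; have [wV wA vw] := SP_head dA bA hA.
rewrite /= SP_U //; set w := fmin _ in wV wA vw *; exists w; split=> //.
apply/fsetP=> -[a b]; rewrite !inE /= -/v.
case abA : (_ \in A); last by rewrite !orbF; apply/esym/eqP => -[E1 E2]; rewrite E1 E2 wA in abA.
have [aV bV ltba] := bvalid_arrow vA abA.
have va := fmin_le aV; have vb := fmin_le bV; rewrite -/v in va vb.
rewrite aV bV /= xpair_eqE.
have wmin : b = v -> w <= a.
  by move=> bv; apply: fmin_le; rewrite !inE /= aV -[fmin V]bv.
have := valid_compat vA.1 abA wA; have := valid_compat vA.1 wA abA.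
rewrite !compat_backward //.
have [bv|nbv] := eqVneq b v; first by have := wmin bv; lia.
by lia.
Qed.

(** Arrows of [B] stay in the interval above [v] up to [w]; those of [C] start beyond [w] and end at
    [v] or beyond [w]. So arrows of different origin can neither cross nor chain head to tail. *)
Lemma SP_U_glue w B C : w \in V -> v < w ->
  bvalid (inner w) B -> bvalid (outside w) C ->
  let A := (w, v) |` (B `|` C) in
  bvalid V A /\ SP V A = U :: SP (inner w) B ++ D :: SP (outside w) C.
Proof.
move=> wV vw vB vC A.
have vV : v \in V by apply: fmin_in; apply/fset0Pn; exists w.
have inA (a b : nat) : (a, b) \in A = [|| (a == w) && (b == v), (a, b) \in B | (a, b) \in C].
  by rewrite !inE.
clearbody A; have arrB (a b : nat) : (a, b) \in B -> [/\ a \in V, b \in V, v < b & b < a <= w].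
  move=> /(bvalid_arrow vB)[]; rewrite !inE -/v => /andP[-> ?] /andP[-> ?] ?.
  by split=> //; lia.
have arrC (a b : nat) : (a, b) \in C ->
    [/\ a \in V, b \in V, (b == v) || (w < b), w < a & b < a].
  move=> /(bvalid_arrow vC)[]; rewrite !inE -/v => /andP[aV ?] /andP[bV ?] ?.
  have va := fmin_le aV; have vb := fmin_le bV; rewrite -/v in va vb.
  by split=> //; lia.
have bA : {in A, forall a, backward a}.
  move=> [a b]; rewrite /backward inA /= => /or3P[/andP[/eqP-> /eqP->]|/arrB[]|/arrC[]] //.
  by lia.
have dA : digraph_on V A.
  move=> [a b] abA; have := bA _ abA; rewrite /backward /= => ltba.
  rewrite (gtn_eqF ltba) andbT; move: abA.
  by rewrite inA => /or3P[/andP[/eqP-> /eqP->]|/arrB[-> ->]|/arrC[-> ->]] //=; rewrite wV vV.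
have vA : bvalid V A.
  split=> //; apply/validE; split=> // -[a b] [c d].
  rewrite !inA => /or3P[/andP[/eqP-> /eqP->]|abB|abC] /or3P[/andP[/eqP-> /eqP->]|cdB|cdC];
    (try exact: (valid_compat vB.1)); (try exact: (valid_compat vC.1));
    (try case: (arrB _ _ abB)); (try case: (arrB _ _ cdB));
    (try case: (arrC _ _ abC)); (try case: (arrC _ _ cdC));
    move=> *; rewrite compat_backward; lia.
split=> //.
have hA : on_arrow A v by apply/hasP; exists (w, v); rewrite ?inA /= ?eqxx ?orbT.
(* No arrow of [B] reaches [v], and those of [C] that do come from beyond [w]. *)
have Ew : fmin [fset x in V | (x, v) \in A] = w.
  apply: fmin_eq => [|z]; first by rewrite !inE /= wV inA !eqxx.
  rewrite !inE /= inA => /andP[_ /or3P[/andP[/eqP-> _]//|/arrB[]|/arrC[]]]; lia.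
rewrite SP_U // -/v Ew.
congr (U :: SP _ _ ++ D :: SP _ _); apply/fsetP => -[a b];
  rewrite in_restr inA /= !inE /= -/v; apply/idP/idP.
- case/and3P => /or3P[/andP[/eqP-> /eqP->]|//|/arrC[_ _]] *; lia.
- by move=> abB; case: (arrB _ _ abB) => -> -> *; rewrite abB orbT /=; lia.
- case/and3P => /or3P[/andP[/eqP-> /eqP->]|/arrB[_ _]|//] *; lia.
- by move=> abC; case: (arrC _ _ abC) => -> -> *; rewrite abC !orbT /=; lia.
Qed.
End MinOnArrow.

(** * Bijectivity of [SP] *)

Lemma inner_inj V w w' : w \in V -> w' \in V -> fmin V < w -> fmin V < w' ->
  #|` inner V w| = #|` inner V w'| -> w = w'.
Proof.
wlog lt : w w' / w < w' => [h wV w'V vw vw' E|wV w'V vw vw' E].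
  by have [lt|gt|//] := ltngtP w w'; [|apply/esym]; apply: h.
suff : #|` inner V w| < #|` inner V w'| by rewrite E ltnn.
apply: (@fcard_lt _ _ w') => [z||]; rewrite !inE /=; last lia.
  by case: (z \in V) => //=; lia.
by rewrite w'V; lia.
Qed.

Lemma card_inner_outside V w : #|` inner V w| + #|` outside V w| = #|` V|.
Proof. exact: card_split. Qed.

Lemma inner_gt0 V w : w \in V -> fmin V < w -> 0 < #|` inner V w|.
Proof.
by move=> wV vw; rewrite cardfs_gt0; apply/fset0Pn; exists w; rewrite !inE /= wV vw leqnn.
Qed.

Lemma outside_gt0 V w : w \in V -> 0 < #|` outside V w|.
Proof.
move=> wV; rewrite cardfs_gt0; apply/fset0Pn; exists (fmin V).
by rewrite !inE /= ltnn fmin_in //; apply/fset0Pn; exists w.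
Qed.

Lemma SP_schroder n (V : {fset nat}) A : #|` V| = n.+1 -> bvalid V A -> schroder n (SP V A).
Proof.
elim/ltn_ind: n V A => n IH V A cV vA.
case: n IH cV => [|n] IH cV.
  have /cardfs1P[v Ev] : #|` V| == 1 by rewrite cV.
  by rewrite Ev SP_single; exact/schroder_nil.
have V_gt1 : 1 < #|` V| by rewrite cV.
have V0 : V != fset0 by rewrite -cardfs_gt0 cV.
have [hA|nA] := boolP (on_arrow A (fmin V)).
  have [w [wV vw EA ->]] := SP_U_split V_gt1 vA hA.
  have := card_inner_outside V w; have := inner_gt0 wV vw; have := outside_gt0 wV.
  case Ei: #|` inner V w| => [//|i]; case Eo: #|` outside V w| => [//|o] _ _ c.
  have -> : n.+1 = (i + o).+1 by lia.
  by apply: schroder_glue; apply: IH => //; (try lia); exact: bvalid_restr vA.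
have [vA' ->] := SP_H_split V_gt1 vA nA.
apply/schroder_H; split=> //; apply: IH => //.
by have := cardfsD1 (fmin V) V; rewrite fmin_in // cV; lia.
Qed.

(** The first letter tells whether the minimum lies on an arrow. After a [U], the unique first
    descent separates the words of the two parts. *)
Lemma SP_inj n (V : {fset nat}) A A' : #|` V| = n.+1 -> bvalid V A -> bvalid V A' ->
  SP V A = SP V A' -> A = A'.
Proof.
elim/ltn_ind: n V A A' => n IH V A A' cV vA vA'.
case: n IH cV => [|n] IH cV.
  have /cardfs1P[v Ev] : #|` V| == 1 by rewrite cV.
  by rewrite Ev in vA vA'; rewrite (bvalid_fset1 vA) (bvalid_fset1 vA').
have V_gt1 : 1 < #|` V| by rewrite cV.
have V0 : V != fset0 by rewrite -cardfs_gt0 cV.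
have [hA|nA] := boolP (on_arrow A (fmin V)); last first.
  have [bA ->] := SP_H_split V_gt1 vA nA.
  have [hA'|nA'] := boolP (on_arrow A' (fmin V)).
    by have [w [_ _ _ ->]] := SP_U_split V_gt1 vA' hA'.
  have [bA' ->] := SP_H_split V_gt1 vA' nA'.
  case; apply: (IH n) bA bA' => //.
  by have := cardfsD1 (fmin V) V; rewrite fmin_in // cV; lia.
have [hA'|nA'] := boolP (on_arrow A' (fmin V)); last first.
  have [_ ->] := SP_H_split V_gt1 vA' nA'.
  by have [w [_ _ _ ->]] := SP_U_split V_gt1 vA hA.
have [w [wV vw EA ->]] := SP_U_split V_gt1 vA hA.
have [w' [w'V vw' EA' ->]] := SP_U_split V_gt1 vA' hA'.
have := card_inner_outside V w; have := inner_gt0 wV vw; have := outside_gt0 wV.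
case Ei: #|` inner V w| => [//|i]; case Eo: #|` outside V w| => [//|o] _ _ c [].
have := inner_gt0 w'V vw'; case Ei': #|` inner V w'| => [//|i'] _.
have sB := SP_schroder Ei (bvalid_restr (inner V w) vA).
have sB' := SP_schroder Ei' (bvalid_restr (inner V w') vA').
case/(first_descent_uniq sB sB') => E1 E2.
(* The two inner digraphs may a priori live on different node sets; the half-length of their common
   word gives equal cardinals, hence the same [w]. *)
have Ew : w = w'.
  apply: (@inner_inj V) => //; rewrite Ei Ei'; congr _.+1.
  by apply: delannoy_inj sB.2 _; rewrite E1; exact: sB'.2.
rewrite EA EA'; move: E1 E2; rewrite -Ew => E1 E2.
congr (_ |` (_ `|` _)); [move: E1|move: E2].
  by apply: (IH i) => //; (try lia); first [exact: bvalid_restr vA|exact: bvalid_restr vA'].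
by apply: (IH o) => //; (try lia); first [exact: bvalid_restr vA|exact: bvalid_restr vA'].
Qed.

Lemma SP_surj n (V : {fset nat}) s : #|` V| = n.+1 -> schroder n s ->
  exists2 A, bvalid V A & SP V A = s.
Proof.
elim/ltn_ind: n V s => n IH V s cV ss.
case: (schroder_split ss) => [E|[t E]|[i [o [a [b [E sa sb En]]]]]]; rewrite {}E in ss *.
- move: ss cV => /schroder_nil -> cV.
  have /cardfs1P[v ->] : #|` V| == 1 by rewrite cV.
  by exists fset0; [exact: bvalid_fset0|exact: SP_single].
- case/schroder_H: ss => n0 st.
  have V_gt1 : 1 < #|` V| by lia.
  have V0 : V != fset0 by rewrite -cardfs_gt0 cV.
  have [||A vA <-] := IH n.-1 _ (V `\ fmin V) t _ st; first lia.
    by have := cardfsD1 (fmin V) V; rewrite fmin_in // cV; lia.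
  by have [vA' E] := SP_H_glue V_gt1 vA; exists A.
have V_gt1 : 1 < #|` V| by lia.
(* The rank counts the [i.+1] nodes of [inner V w] and the minimum of [V]. *)
have [|w wV Ew] := @exists_rank V i.+2; first lia.
have Ei := card_above_min wV; rewrite Ew -/(inner V w) in Ei; case: Ei => Ei.
have c := card_inner_outside V w.
have vw : fmin V < w.
  have : inner V w != fset0 by rewrite -cardfs_gt0 Ei.
  by case/fset0Pn=> z; rewrite !inE /= => /andP[_]; lia.
have [||B vB <-] := IH i _ (inner V w) a _ sa; first lia; first by [].
rewrite Ei in c.
have [||C vC <-] := IH o _ (outside V w) b _ sb; [lia|lia|].
by have [vA E] := SP_U_glue V_gt1 wV vw vB vC; eexists; first exact: vA.
Qed.

(** * Twisting *)

(** Inverse of [tw]. Before the twist the maximum is the head of [(v, w)], hence the tail of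
    nothing; so every arrow leaving it afterwards came from [v]. *)
Definition untwist (V : {fset nat}) (N : {fset nat * nat}) : {fset nat * nat} :=
  let v := fmin V in let w := fmax V in
  (v, w) |` ([fset a in N | a.1 != w] `|`
             [fset (v, b) | b in [fset b in V | (w, b) \in N]]).

Section Twist.
Variable V : {fset nat}.
Let v := fmin V.
Let w := fmax V.
Hypothesis vw : v < w.

Let V0 : V != fset0.
Proof.
apply/eqP => V0; have := vw; rewrite /w /v V0.
by rewrite /fmax big_seq big1 // => i; rewrite inE.
Qed.

Let vV : v \in V. Proof. exact: fmin_in. Qed.
Let wV : w \in V. Proof. exact: fmax_in. Qed.

Let arrow_bounds A (a b : nat) : valid V A -> (a, b) \in A ->
  [/\ a \in V, b \in V, a != b & [&& v <= a, a <= w, v <= b & b <= w]].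
Proof.
move=> vA abA; have [aV bV ->] := valid_arrow vA abA; split=> //.
by rewrite !fmin_le ?fmax_le.
Qed.

(** As the tail of [(v, w)], [v] is no head, so deleting this node only discards arrows leaving
    it. *)
Lemma twE A (a b : nat) : valid V A -> (v, w) \in A ->
  ((a, b) \in tw V A) =
  ((a, b) \in A) && (a != v) || [&& a == w, b != w & (v, b) \in A].
Proof.
move=> vA vwA; rewrite /tw -/v -/w in_fsetU in_restr; congr orb.
  rewrite !inE /=.
  case abA: (_ \in A) => //=.
  have [aV bV nab _] := arrow_bounds vA abA; rewrite aV bV !andbT.
  have := valid_compat vA abA vwA.
  by rewrite compatE => /andP[-> _]; rewrite andbT.
apply/imfsetP/and3P => [[z]|[/eqP-> bw vbA]].
  by rewrite !inE /= => /and3P[_ ? ?] [-> ->].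
exists b => //; rewrite !inE /= vbA bw.
by have [_ ->] := arrow_bounds vA vbA.
Qed.

Lemma untwistE N (a b : nat) : valid (V `\ v) N ->
  ((a, b) \in untwist V N) =
  [|| (a == v) && (b == w), (a != w) && ((a, b) \in N)
    | (a == v) && ((w, b) \in N)].
Proof.
move=> vN; rewrite /untwist -/v -/w in_fset1U in_fsetU xpair_eqE; congr [|| _, _ | _].
  by rewrite !inE andbC.
apply/imfsetP/andP => [[z]|[/eqP-> wbN]].
  by rewrite !inE /= => /andP[_ ?] [-> ->].
exists b => //; rewrite !inE /= wbN.
by have [_] := valid_arrow vN wbN; rewrite !inE => /andP[_ ->].
Qed.

(** Let [(v, b)] be twisted to [(w, b)]. No arrow with another tail than [v] straddles [b]: a
    forward one nests inside [(v, b)], a backward one would cross or nest [(v, b)]. So the new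
    interval, from [b] to [w], is crossed by none of them and contains no forward one. *)
Lemma tw_valid A : valid V A -> (v, w) \in A -> valid (V `\ v) (tw V A).
Proof.
move=> vA vwA; apply/validE; split; first by apply: digraph_on_tw; case: vA.
move=> [a b] [c d]; rewrite !twE //.
have bounds (p q : nat) (h : (p, q) \in A) :=
  (arrow_bounds vA h, valid_compat vA h vwA, valid_compat vA vwA h).
have both (p q p' q' : nat) (h : (p, q) \in A) (h' : (p', q') \in A) :=
  conj (valid_compat vA h h') (valid_compat vA h' h).
move=> /orP[/andP[abA av]|/and3P[/eqP-> nbw vbA]]
  /orP[/andP[cdA cv]|/and3P[/eqP-> ndw vdA]].
- exact: valid_compat vA abA cdA.
- have [[[_ _ nab ab] c1] c2] := bounds _ _ abA.
  have [[[_ _ nvd /and4P[_ _ vd dw]] c3] c4] := bounds _ _ vdA.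
  have vltd : v < d by rewrite ltn_neqAle nvd.
  have wged : (w < d) = false by rewrite ltnNge dw.
  have := both _ _ _ _ abA vdA; move: c1 c2 c3 c4.
  rewrite !compatE vw vltd wged; case: (ltngtP a b) nab => //=; lia.
- have [[[_ _ ncd cd] c1] c2] := bounds _ _ cdA.
  have [[[_ _ nvb /and4P[_ _ vb bw]] c3] c4] := bounds _ _ vbA.
  have vltb : v < b by rewrite ltn_neqAle nvb.
  have wgeb : (w < b) = false by rewrite ltnNge bw.
  have := both _ _ _ _ cdA vbA; move: c1 c2 c3 c4.
  rewrite !compatE vw vltb wgeb; case: (ltngtP c d) ncd => //=; lia.
(* Two twisted arrows share the tail [w], so their intervals share an endpoint. *)
have [[[_ _ _ vb] _] _] := bounds _ _ vbA.
have [[[_ _ _ vd] _] _] := bounds _ _ vdA.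
have wgeb : (w < b) = false by lia.
have wged : (w < d) = false by lia.
rewrite !compatE wgeb wged; lia.
Qed.

(** Let [(w, b)] be turned back into [(v, b)]. A forward arrow of [N] cannot end at the tail [w];
    neither crossed nor nested by [(w, b)], it ends at [b] or before and nests in [(v, b)]. A
    backward arrow with another tail lies on one side of [b], since it does not cross [(w, b)]. *)
Lemma untwist_valid N : valid (V `\ v) N -> valid V (untwist V N).
Proof.
move=> vN.
have bounds (p q : nat) : (p, q) \in N ->
    [/\ p \in V, q \in V, p != q, v < p <= w & v < q <= w].
  move=> h; have [] := valid_arrow vN h; rewrite !inE => /andP[pv pV] /andP[qv qV] pq.
  by split=> //; rewrite fmax_le // andbT ltn_neqAle eq_sym ?pv ?qv fmin_le.
have both (p q p' q' : nat) (h : (p, q) \in N) (h' : (p', q') \in N) :=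
  conj (valid_compat vN h h') (valid_compat vN h' h).
apply/validE; split.
  move=> [a b]; rewrite untwistE //= => /or3P[/andP[/eqP-> /eqP->]|/andP[_ /bounds[-> ->]]|] //.
    by rewrite vV wV neq_ltn vw.
  by move=> /andP[/eqP-> /bounds[_ -> _ _ /andP[vb _]]]; rewrite vV neq_ltn vb.
move=> [a b] [c d]; rewrite !untwistE //.
move=> /or3P[/andP[/eqP-> /eqP->]|/andP[aw abN]|/andP[/eqP-> wbN]]
  /or3P[/andP[/eqP-> /eqP->]|/andP[cw cdN]|/andP[/eqP-> wdN]].
- by rewrite compatE vw !leqnn gtn_eqF.
- have [_ _ ? ? ?] := bounds _ _ cdN; rewrite compatE vw; case: ltnP; lia.
- have [_ _ _ _ /andP[vd dw]] := bounds _ _ wdN.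
  by rewrite compatE vw vd leqnn dw gtn_eqF.
- have [_ _ ? ? ?] := bounds _ _ abN; rewrite compatE vw; case: ltnP; lia.
- exact: valid_compat vN abN cdN.
- have [_ _ ? ? ?] := bounds _ _ abN; have [_ _ wd ? /andP[vd dw]] := bounds _ _ wdN.
  have wged : (w < d) = false by rewrite ltnNge dw.
  have := both _ _ _ _ abN wdN; rewrite !compatE vd wged.
  by case: (ltngtP a b); lia.
- have [_ _ _ _ /andP[vb bw]] := bounds _ _ wbN.
  by rewrite compatE vw vb leqnn bw orbT gtn_eqF.
- have [_ _ ? ? ?] := bounds _ _ cdN; have [_ _ wb ? /andP[vb bw]] := bounds _ _ wbN.
  have wgeb : (w < b) = false by rewrite ltnNge bw.
  have := both _ _ _ _ cdN wbN; rewrite !compatE vb wgeb.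
  by case: (ltngtP c d); lia.
have [_ _ _ _ /andP[vb _]] := bounds _ _ wbN.
have [_ _ _ _ /andP[vd _]] := bounds _ _ wdN.
by rewrite compatE vb vd !leqnn leq_total gtn_eqF.
Qed.

Lemma untwist_outer N : (v, w) \in untwist V N.
Proof. by rewrite !inE eqxx. Qed.

Lemma untwistK N : valid (V `\ v) N -> tw V (untwist V N) = N.
Proof.
move=> vN; apply/fsetP => -[a b].
rewrite (twE _ _ (untwist_valid vN) (untwist_outer N)) !untwistE //.
have vN' q : ((v, q) \in N) = false.
  by apply/negP => /(valid_arrow vN)[]; rewrite !inE eqxx.
have nww : (w, w) \notin N by apply/negP => /(valid_arrow vN)[_ _ /eqP].
rewrite vN' andbF eqxx /=.
have [->|nav] := eqVneq a v; first by rewrite andbF vN' (ltn_eqF vw).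
have [->|naw] := eqVneq a w; last by rewrite !orbF andbT.
have [->|nbw] := eqVneq b w; last by [].
by rewrite (negPf nww).
Qed.

Lemma twK A : valid V A -> (v, w) \in A -> untwist V (tw V A) = A.
Proof.
move=> vA vwA; apply/fsetP => -[a b].
rewrite (untwistE _ _ (tw_valid vA vwA)) !twE //.
(* [w] is the head of [(v, w)], so it is no tail. *)
have wA q : ((w, q) \in A) = false.
  by apply/negP => h; have := valid_compat vA vwA h; rewrite compatE eqxx.
have [->|nav] := eqVneq a v; rewrite /= ?andbF /= ?orbF.
  have [->|nbw] := eqVneq b w; first by rewrite vwA.
  by rewrite wA eqxx (ltn_eqF vw).
have [->|naw] := eqVneq a w; first by rewrite wA.
by rewrite /= ?andbT ?orbF ?andbT.
Qed.
End Twist.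

(** * Decomposition along the outermost forward arrow *)

(** Neighbouring parts share a node: [x] lies in [left] and [middle], [y] in [middle] and
    [right]. *)
Definition left (V : {fset nat}) (x : nat) : {fset nat} := [fset z in V | z <= x].
Definition middle (V : {fset nat}) (x y : nat) : {fset nat} :=
  [fset z in V | x <= z <= y].
Definition right (V : {fset nat}) (y : nat) : {fset nat} := [fset z in V | y <= z].

(** Forward arrows nest pairwise, so one of maximal length nests all of them. *)
Lemma exists_outermost V A : valid V A -> has forward A ->
  exists x y, outermost A (x, y).
Proof.
move=> vA /hasP[a0 a0A fa0].
pose a := [arg max_(i > [` a0A] | forward (val i)) ((val i).2 - (val i).1)].
have := erefl a; rewrite {1}/a; case: arg_maxnP => //= -[[x y] xyA] /= fxy mx _.
exists x, y; apply/and3P; split=> //; apply/allP => b bA; apply/implyP => fb.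
have := mx [` bA] fb; have := valid_compat vA xyA bA.
case: b bA fb => c d bA; rewrite /= compatE nestsE /forward /= in fxy * => fb.
rewrite fxy fb /lo /hi /= !(minn_idPl (ltnW _)) ?(maxn_idPr (ltnW _)) //.
by lia.
Qed.

Section Decomposition.
Variables (V : {fset nat}) (x y : nat).
Hypotheses (xV : x \in V) (yV : y \in V) (xy : x < y).

Let fmin_middle : fmin (middle V x y) = x.
Proof.
apply: fmin_eq => [|z]; first by rewrite !inE /= xV leqnn ltnW.
by rewrite !inE /= => /and3P[].
Qed.

Let fmax_middle : fmax (middle V x y) = y.
Proof.
apply: fmax_eq => [|z]; first by rewrite !inE /= yV leqnn ltnW.
by rewrite !inE /= => /and3P[].
Qed.

Lemma DP_split A : valid V A -> outermost A (x, y) ->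
  let B := restr A (left V x) in let C := restr A (right V y) in
  let N := tw (middle V x y) (restr A (middle V x y)) in
  [/\ bvalid (left V x) B, bvalid (right V y) C, valid (middle V x y `\ x) N,
    A = B `|` C `|` untwist (middle V x y) N
    & DP V A = SP (left V x) B ++
        D :: DP (middle V x y `\ x) N ++ U :: SP (right V y) C].
Proof.
move=> vA oA B C N; case/and3P: (oA) => xyA _ /allP oxy.
(* Forward arrows are nested by [(x, y)]. A backward arrow neither crosses nor nests [(x, y)], so it
   ends up on one side or between [x] and [y]. *)
have loc (a b : nat) : (a, b) \in A -> [/\ a \in V, b \in V, a != b &
    [|| (b < a) && (a <= x), (y <= b) && (b < a)
      | [&& x <= a, a <= y, x <= b & b <= y]]].
  move=> abA; have [aV bV nab] := valid_arrow vA abA; split=> //.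
  have := valid_compat vA abA xyA; have := valid_compat vA xyA abA.
  have := oxy _ abA; rewrite !compatE nestsE /forward /lo /hi /= xy.
  case: (ltngtP a b) nab => //= ab _.
    by rewrite !(minn_idPl (ltnW _)) ?(maxn_idPr (ltnW _)) //; lia.
  by move=> _; lia.
have xyM : (x, y) \in restr A (middle V x y).
  by rewrite in_restr !inE /= xyA xV yV !leqnn ltnW.
have vM : valid (middle V x y) (restr A (middle V x y)) := valid_restr _ vA.
have vN : valid (middle V x y `\ x) N.
  have := @tw_valid (middle V x y); rewrite fmin_middle fmax_middle; exact.
split=> //.
- split; first exact: valid_restr vA.
  move=> [a b]; rewrite in_restr !inE /= => /and3P[/loc[-> -> nab h] ax bx].
  by rewrite /backward /=; lia.
- split; first exact: valid_restr vA.
  move=> [a b]; rewrite in_restr !inE /= => /and3P[/loc[-> -> nab h] ay bY].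
  by rewrite /backward /=; lia.
- rewrite twK ?fmin_middle ?fmax_middle //.
  apply/fsetP => -[a b]; rewrite !in_fsetU !in_restr.
  case abA: (_ \in A) => //; rewrite !inE /=.
  by have [-> -> nab h] := loc _ _ abA; rewrite /=; lia.
by have := DP_twist vA.1 oA.
Qed.

(** Arrows of different parts can only meet at [x] or [y]. In [B] and in the untwisted middle [x]
    occurs only as a tail, and in [C] and the middle [y] occurs only as a head, so no head meets a
    tail. *)
Lemma DP_glue B C N : bvalid (left V x) B -> bvalid (right V y) C ->
  valid (middle V x y `\ x) N ->
  let A := B `|` C `|` untwist (middle V x y) N in
  valid V A /\
  DP V A = SP (left V x) B ++
    D :: DP (middle V x y `\ x) N ++ U :: SP (right V y) C.
Proof.
move=> vB vC vN; set M := untwist _ N => A.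
have vN' : valid (middle V x y `\ fmin (middle V x y)) N by rewrite fmin_middle.
have xy' : fmin (middle V x y) < fmax (middle V x y).
  by rewrite fmin_middle fmax_middle.
have vM : valid (middle V x y) M := untwist_valid xy' vN'.
have xyM : (x, y) \in M.
  by have := untwist_outer (middle V x y) N; rewrite fmin_middle fmax_middle.
have twM : tw (middle V x y) M = N := untwistK xy' vN'.
have inA (a b : nat) :
    (a, b) \in A = [|| (a, b) \in B, (a, b) \in C | (a, b) \in M].
  by rewrite /A !in_fsetU -orbA.
clearbody A M.
have arrB (a b : nat) : (a, b) \in B -> [/\ a \in V, b \in V & b < a <= x].
  move=> /(bvalid_arrow vB)[]; rewrite !inE /= => /andP[-> ax] /andP[-> _] ->.
  by rewrite ax.
have arrC (a b : nat) : (a, b) \in C -> [/\ a \in V, b \in V & y <= b < a].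
  move=> /(bvalid_arrow vC)[]; rewrite !inE /= => /andP[-> _] /andP[-> yb] ->.
  by rewrite yb.
have arrM (a b : nat) : (a, b) \in M ->
    [/\ a \in V, b \in V, a != b, x <= a < y & x < b <= y].
  move=> abM; have [] := valid_arrow vM abM.
  rewrite !inE /= => /and3P[-> xa ay] /and3P[-> xb bY] ->.
  have := valid_compat vM abM xyM; have := valid_compat vM xyM abM.
  rewrite !compatE => /andP[ya _] /andP[bx _].
  by rewrite !ltn_neqAle xa ay xb bY (eq_sym a) ya (eq_sym x) bx.
have vA : valid V A.
  apply/validE; split.
    move=> [a b]; rewrite inA /= => /or3P[/arrB[-> -> /andP[ba _]]
      |/arrC[-> -> /andP[_ ba]]|/arrM[-> -> ->]] //; by rewrite gtn_eqF.
  move=> [a b] [c d]; rewrite !inA => /or3P[abB|abC|abM] /or3P[cdB|cdC|cdM].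
  - exact: valid_compat vB.1 abB cdB.
  - have [_ _ /andP[ba ax]] := arrB _ _ abB; have [_ _ /andP[yd dc]] := arrC _ _ cdC.
    by rewrite compat_backward //; lia.
  - have [_ _ /andP[ba ax]] := arrB _ _ abB; have [_ _ ? ? ?] := arrM _ _ cdM.
    by rewrite compatE ltnNge (ltnW ba) /=; case: ltnP; lia.
  - have [_ _ /andP[yb ba]] := arrC _ _ abC; have [_ _ /andP[dc cx]] := arrB _ _ cdB.
    by rewrite compat_backward //; lia.
  - exact: valid_compat vC.1 abC cdC.
  - have [_ _ /andP[yb ba]] := arrC _ _ abC; have [_ _ ? ? ?] := arrM _ _ cdM.
    by rewrite compatE ltnNge (ltnW ba) /=; case: ltnP; lia.
  - have [_ _ ? ? ?] := arrM _ _ abM; have [_ _ /andP[dc cx]] := arrB _ _ cdB.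
    by rewrite compatE (ltnNge c d) (ltnW dc) /=; case: ltnP; lia.
  - have [_ _ ? ? ?] := arrM _ _ abM; have [_ _ /andP[yd dc]] := arrC _ _ cdC.
    by rewrite compatE (ltnNge c d) (ltnW dc) /=; case: ltnP; lia.
  exact: valid_compat vM abM cdM.
have rB : restr A (left V x) = B.
  apply/fsetP => -[a b]; rewrite in_restr inA !inE /=; apply/idP/idP.
    case/and3P=> /or3P[//|/arrC[_ _]|/arrM[_ _ _]]; lia.
  by move=> abB; case: (arrB _ _ abB) => -> -> ?; rewrite abB /=; lia.
have rC : restr A (right V y) = C.
  apply/fsetP => -[a b]; rewrite in_restr inA !inE /=; apply/idP/idP.
    case/and3P=> /or3P[/arrB[_ _]|//|/arrM[_ _ _]]; lia.
  by move=> abC; case: (arrC _ _ abC) => -> -> ?; rewrite abC orbT /=; lia.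
have rM : restr A (middle V x y) = M.
  apply/fsetP => -[a b]; rewrite in_restr inA !inE /=; apply/idP/idP.
    case/and3P=> /or3P[/arrB[_ _]|/arrC[_ _]|//]; lia.
  by move=> abM; case: (arrM _ _ abM) => -> -> ? ? ?; rewrite abM !orbT /=; lia.
(* Forward arrows come from the middle part only, whose nodes lie between [x] and [y]. *)
have oA : outermost A (x, y).
  apply/and3P; split=> //; first by rewrite inA xyM !orbT.
  apply/allP => -[a b]; rewrite inA /forward => abA; apply/implyP => /= ab.
  rewrite nestsE /lo /hi /= !(minn_idPl (ltnW _)) ?(maxn_idPr (ltnW _)) //.
  by case/or3P: abA => [/arrB[_ _]|/arrC[_ _]|/arrM[_ _ _]]; lia.
split=> //; have := DP_twist vA.1 oA.
by rewrite /= -/(left V x) -/(middle V x y) -/(right V y) rB rC rM twM.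
Qed.
End Decomposition.

(** [y] is counted in two of the parts, every other node in one. Here [i], [j], [k] are the
    half-lengths of the three factors of the word. *)
Lemma card_decomposition (V : {fset nat}) (x y : nat) :
  x \in V -> y \in V -> x < y -> exists i j k,
  [/\ #|` left V x| = i.+1, #|` middle V x y `\ x| = j.+1,
      #|` right V y| = k.+1 & #|` V| = (i + j + k).+2].
Proof.
move=> xV yV xy.
have c1 := card_le_ge yV; have c2 := card_le_between (ltnW xy) xV.
have pos (W : {fset nat}) z : z \in W -> exists m, #|` W| = m.+1.
  by move=> zW; exists #|` W|.-1; rewrite prednK // cardfs_gt0; apply/fset0Pn; exists z.
have [|i Ei] := pos (left V x) x; first by rewrite !inE /= xV leqnn.
have [|j Ej] := pos (middle V x y `\ x) y.
  by rewrite !inE /= yV leqnn (ltnW xy) gtn_eqF.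
have [|k Ek] := pos (right V y) y; first by rewrite !inE /= yV leqnn.
exists i, j, k; split=> //; move: c1; rewrite -c2 -/(left V x) -/(right V y).
by rewrite -/(middle V x y) Ei Ej Ek; lia.
Qed.

(** * Bijectivity of [DP] *)

Lemma left_inj (V : {fset nat}) (x x' : nat) : x \in V -> x' \in V ->
  #|` left V x| = #|` left V x'| -> x = x'.
Proof.
wlog lt : x x' / x < x' => [h xV x'V E|xV x'V E].
  by have [lt|gt|//] := ltngtP x x'; [|apply/esym]; apply: h.
suff : #|` left V x| < #|` left V x'| by rewrite E ltnn.
apply: (@fcard_lt _ _ x') => [z||]; rewrite !inE /=; last lia.
  by case: (z \in V) => //=; lia.
by rewrite x'V leqnn.
Qed.

Lemma right_inj (V : {fset nat}) (y y' : nat) : y \in V -> y' \in V ->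
  #|` right V y| = #|` right V y'| -> y = y'.
Proof.
wlog lt : y y' / y < y' => [h yV y'V E|yV y'V E].
  by have [lt|gt|//] := ltngtP y y'; [|apply/esym]; apply: h.
suff : #|` right V y'| < #|` right V y| by rewrite E ltnn.
apply: (@fcard_lt _ _ y) => [z||]; rewrite !inE /=; last lia.
  by case: (z \in V) => //=; lia.
by rewrite yV leqnn.
Qed.

Lemma outermost_lt V A (x y : nat) : valid V A -> outermost A (x, y) ->
  [/\ x \in V, y \in V & x < y].
Proof. by move=> vA /and3P[/(valid_arrow vA)[-> -> _] fxy _]. Qed.

Lemma no_forward_bvalid V A : valid V A -> ~~ has forward A -> bvalid V A.
Proof.
move=> vA nA; split=> // -[a b] abA; have [_ _ nab] := valid_arrow vA abA.
by have := hasPn nA _ abA; rewrite /forward /backward /= -leqNgt leq_eqVlt eq_sym (negPf nab).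
Qed.

Lemma DP_delannoy n (V : {fset nat}) A :
  #|` V| = n.+1 -> valid V A -> delannoy n (DP V A).
Proof.
elim/ltn_ind: n V A => n IH V A cV vA.
have [fA|nA] := boolP (has forward A); last first.
  rewrite (DP_SP vA.1 nA).
  by apply: (SP_schroder cV _).2; exact: no_forward_bvalid.
have [x [y oA]] := exists_outermost vA fA; have [xV yV xy] := outermost_lt vA oA.
have [vB vC vN _ ->] := DP_split xV yV xy vA oA.
have [i [j [k [Ei Ej Ek E]]]] := card_decomposition xV yV xy.
have -> : n = (i + j + k).+1 by apply: succn_inj; rewrite -cV -E.
apply: delannoy_glue (SP_schroder Ei vB) _ (SP_schroder Ek vC).
by apply: IH => //; move: cV; rewrite E; lia.
Qed.

(** First descent and last ascent are unique, so equal words have equal factors; the half-lengths of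
    the outer factors then give [x] and [y], and all three parts can be compared on common node
    sets. *)
Lemma DP_inj n (V : {fset nat}) A A' : #|` V| = n.+1 ->
  valid V A -> valid V A' -> DP V A = DP V A' -> A = A'.
Proof.
(* A forward arrow makes the word dip below the axis, while a digraph without one has a Schröder
   word. *)
have mixed m (W : {fset nat}) A1 A2 : #|` W| = m.+1 -> valid W A1 -> valid W A2 ->
    ~~ has forward A1 -> has forward A2 -> DP W A1 = DP W A2 -> False.
  move=> cW v1 v2 n1 f2; rewrite (DP_SP v1.1 n1).
  have [x [y oA]] := exists_outermost v2 f2; have [xV yV xy] := outermost_lt v2 oA.
  have [vB _ _ _ ->] := DP_split xV yV xy v2 oA.
  have [i [_ [_ [Ei _ _ _]]]] := card_decomposition xV yV xy.
  have := SP_schroder cW (no_forward_bvalid v1 n1) => /[swap] ->.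
  exact: delannoy_glue_not_schroder (SP_schroder Ei vB).
elim/ltn_ind: n V A A' => n IH V A A' cV vA vA' E.
have [fA|nA] := boolP (has forward A); have [fA'|nA'] := boolP (has forward A').
- have [x [y oA]] := exists_outermost vA fA; have [xV yV xy] := outermost_lt vA oA.
  have [x' [y' oA']] := exists_outermost vA' fA'.
  have [x'V y'V x'y'] := outermost_lt vA' oA'.
  have [vB vC vN EA EDP] := DP_split xV yV xy vA oA.
  have [vB' vC' vN' EA' EDP'] := DP_split x'V y'V x'y' vA' oA'.
  have [i [j [k [Ei Ej Ek EV]]]] := card_decomposition xV yV xy.
  have [i' [_ [k' [Ei' _ Ek' _]]]] := card_decomposition x'V y'V x'y'.
  have sB := SP_schroder Ei vB; have sB' := SP_schroder Ei' vB'.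
  have sC := SP_schroder Ek vC; have sC' := SP_schroder Ek' vC'.
  move: E; rewrite EDP EDP' => /(first_descent_uniq sB sB')[E1].
  case/(last_ascent_uniq sC sC') => E2 E3.
  have Ex : x = x'.
    apply: (@left_inj V) => //; rewrite Ei Ei'; congr _.+1.
    by apply: delannoy_inj sB.2 _; rewrite E1; exact: sB'.2.
  have Ey : y = y'.
    apply: (@right_inj V) => //; rewrite Ek Ek'; congr _.+1.
    by apply: delannoy_inj sC.2 _; rewrite E3; exact: sC'.2.
  subst x' y'; rewrite EA EA' (SP_inj Ei vB vB' E1) (SP_inj Ek vC vC' E3).
  have ltj : j < n by move: cV; rewrite EV; lia.
  congr (_ `|` untwist _ _); exact: (IH j ltj _ _ _ Ej vN vN' E2).
- by case: (mixed _ _ _ _ cV vA' vA).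
- by case: (mixed _ _ _ _ cV vA vA').
apply: (SP_inj cV); try exact: no_forward_bvalid.
by rewrite -(DP_SP vA.1 nA) -(DP_SP vA'.1 nA').
Qed.

Lemma DP_surj n (V : {fset nat}) s : #|` V| = n.+1 -> delannoy n s ->
  exists2 A, valid V A & DP V A = s.
Proof.
elim/ltn_ind: n V s => n IH V s cV ds.
case: (delannoy_split ds) => [ss|[i [j [k [a [d [c [-> sa dd sc En]]]]]]]].
  have [A vA <-] := SP_surj cV ss; exists A; first by case: vA.
  apply: DP_SP; first by case: vA => -[].
  by apply/hasPn => b /vA.2; rewrite /backward /forward -leqNgt => /ltnW.
have [|x xV Ex] := @exists_rank V i.+1; first by rewrite cV En; lia.
(* Up to [y] there are the [i.+1] nodes of the left part and the [j.+1] nodes of the middle part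
   without [x]. *)
have [|y yV Ey] := @exists_rank V (i + j).+2; first by rewrite cV En; lia.
rewrite -/(left V x) in Ex; rewrite -/(left V y) in Ey.
have xy : x < y.
  rewrite ltnNge; apply/negP => yx.
  have : #|` left V y| <= #|` left V x|.
    apply: fsubset_leq_card; apply/fsubsetP => z; rewrite !inE /= => /andP[->].
    by move=> zy; exact: leq_trans yx.
  by rewrite Ex Ey; lia.
have Em : #|` middle V x y `\ x| = j.+1.
  have := card_le_between (ltnW xy) xV.
  by rewrite -/(left V x) -/(left V y) -/(middle V x y) Ex Ey; lia.
have Er : #|` right V y| = k.+1.
  by have := card_le_ge yV; rewrite -/(left V y) -/(right V y) Ey cV En; lia.
have [B vB <-] := SP_surj Ex sa; have [C vC <-] := SP_surj Er sc.
have [|N vN <-] := IH j _ _ _ Em dd; first by rewrite En; lia.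
have [vA E] := DP_glue xV yV xy vB vC vN.
by eexists; first exact: vA.
Qed.

Local Open Scope classical_set_scope.

Theorem theorem8p7 (n : nat) (V : {fset nat})
    (V_pos : forall x : nat, x \in V -> 0 < x) (V_card : #|` V| = n.+1) :
  set_bij [set A : {fset nat * nat} | valid V A]
          [set s : word | balanced_delannoy n s]
          (DP V).
Proof.
split=> [A /= vA|A A'|s /= /balanced_delannoyE ds].
- by apply/balanced_delannoyE; exact: DP_delannoy.
- by rewrite !inE; exact: DP_inj V_card.
have [A vA <-] := DP_surj V_card ds; by exists A.
Qed.
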